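(* Let $s\ge 1$ be an integer. (i) Let $\Delta\subset\mathbb{R}^{2s-1}$ be a $(2s-1)$-dimensional Gorenstein simplex of degree $s$ which is not a lattice pyramid. Then there exists an even binary self-complementary code $C\subset\mathbb{F}_2^{2s}$ such that $$\Lambda_\Delta=\left\{\tfrac12\mathbf{c}\in[0,1)^{2s} : \mathbf{c}\in C\right\}.$$ (ii) Conversely, for every even binary self-complementary code $C\subset\mathbb{F}_2^{2s}$ there exists a $(2s-1)$-dimensional Gorenstein simplex $\Delta$ of degree $s$ which is not a lattice pyramid and such that $\Lambda_\Delta=\left\{\tfrac12\mathbf{c}\in[0,1)^{2s} : \mathbf{c}\in C\right\}$.
   Context: A lattice polytope is a convex polytope in $\mathbb{R}^d$ all of whose vertices lie in $\mathbb{Z}^d$. Two lattice polytopes $P,Q\subset\mathbb{R}^d$ are unimodularly equivalent if $Q=f_U(P)+\mathbf{w}$ for some $\mathbf{w}\in\mathbb{Z}^d$ and some $U\in\mathbb{Z}^{d\times d}$ with $\det U=\pm1$, where $f_U(\mathbf{x})=\mathbf{x}U$. For a lattice polytope $P\subset\mathbb{R}^{d}$ of dimension $d$, $\mathrm{Pyr}(P)=\mathrm{conv}(P\times\{0\},(0,\dots,0,1))\subset\mathbb{R}^{d+1}$; a lattice polytope is a lattice pyramid if, up to unimodular equivalence, it is obtained by successively applying $\mathrm{Pyr}$ (at least once) to a lower-dimensional lattice polytope. For a $d$-dimensional lattice polytope $P\subset\mathbb{R}^d$, $\mathrm{codeg}(P)=\min\{n\in\mathbb{Z}_{>0}:\mathrm{int}(nP)\cap\mathbb{Z}^d\ne\emptyset\}$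 and the degree is $\deg(P)=d+1-\mathrm{codeg}(P)$. A $d$-dimensional lattice polytope $P\subset\mathbb{R}^d$ is reflexive if the origin is in its interior and $P^\vee=\{\mathbf{y}\in\mathbb{R}^d:\langle\mathbf{x},\mathbf{y}\rangle\le1\ \forall\mathbf{x}\in P\}$ is a lattice polytope; $P$ is Gorenstein if $rP$ is unimodularly equivalent to a reflexive polytope for some integer $r\ge1$. A Gorenstein simplex is a lattice simplex that is Gorenstein. For a $d$-dimensional lattice simplex $\Delta=\mathrm{conv}(\mathbf{v}_0,\dots,\mathbf{v}_d)\subset\mathbb{R}^d$ (with a chosen ordering of the vertices), the associated finite abelian group is $\Lambda_\Delta=\{(x_0,\dots,x_d)\in[0,1)^{d+1}:\sum_{i=0}^d x_i(\mathbf{v}_i,1)\in\mathbb{Z}^{d+1}\}$, with coordinatewise addition modulo $1$. A binary linear code of length $n$ is a linear subspace $C\subset\mathbb{F}_2^n$. It is even if every codeword has an even number of nonzero coordinates, and self-complementary if it contains the all-one vector $(1,\dots,1)$. For $\mathbf{c}\in\mathbb{F}_2^n$, $\frac12\mathbf{c}\in[0,1)^n$ has $i$-th coordinate $1/2$ if $c_i=1$ and $0$ if $c_i=0$. *)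

(* Defs.v *)
From HB Require Import structures.
From mathcomp Require Import all_boot all_order all_algebra.
From mathcomp Require Import all_classical all_reals all_analysis.

Set Implicit Arguments.
Unset Strict Implicit.
Unset Printing Implicit Defensive.

Import Order.TTheory GRing.Theory Num.Theory.
Import numFieldNormedType.Exports.

Local Open Scope classical_set_scope.
Local Open Scope ring_scope.

Section LatticePolytopes.
Variable R : realType.

Definition lattice (d : nat) : set 'rV[R]_d :=
  [set x | forall i, x 0 i \is a Num.int].

Definition conv_hull (d : nat) (A : set 'rV[R]_d) : set 'rV[R]_d :=
  smallest (@convex_set R 'rV[R]_d) A.

Definition aff_hull (d : nat) (A : set 'rV[R]_d) : set 'rV[R]_d :=
  [set x | exists n (p : 'I_n -> 'rV[R]_d) (a : 'I_n -> R),
     [/\ forall i, A (p i), \sum_i a i = 1 & x = \sum_i a i *: p i]].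

(* The empty set has no dimension: its affine hull is empty. *)
Definition has_dim (d : nat) (A : set 'rV[R]_d) (k : nat) : Prop :=
  exists (x0 : 'rV[R]_d) (V : {vspace 'rV[R]_d}),
    aff_hull A = [set x0 + u | u in [set u | u \in V]] /\ \dim V = k.

Definition polytope (d : nat) (P : set 'rV[R]_d) : Prop :=
  exists A : set 'rV[R]_d, finite_set A /\ P = conv_hull A.

(* Vertices are the extreme points. *)
Definition vertex (d : nat) (P : set 'rV[R]_d) (v : 'rV[R]_d) : Prop :=
  P v /\ forall (x y : 'rV[R]_d) (t : R), P x -> P y -> 0 < t < 1 ->
    v = t *: x + (1 - t) *: y -> x = v /\ y = v.

Definition lattice_polytope (d : nat) (P : set 'rV[R]_d) : Prop :=
  polytope P /\ forall v, vertex P v -> lattice v.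

Definition unimod_equiv (d : nat) (P Q : set 'rV[R]_d) : Prop :=
  exists (U : 'M[int]_d) (w : 'rV[R]_d),
    [/\ \det U = 1 \/ \det U = -1, lattice w &
        Q = [set x *m map_mx intr U + w | x in P]].

Definition Pyr (d : nat) (P : set 'rV[R]_d) : set 'rV[R]_(d + 1) :=
  conv_hull ([set row_mx x 0 | x in P] `|` [set row_mx 0 (const_mx 1)]).

Inductive iterated_Pyr (d : nat) (Q : set 'rV[R]_d) :
    forall e : nat, set 'rV[R]_e -> Prop :=
  | iterated_Pyr1 : iterated_Pyr Q (Pyr Q)
  | iterated_PyrS (e : nat) (P : set 'rV[R]_e) :
      iterated_Pyr Q P -> iterated_Pyr Q (Pyr P).

Definition lattice_pyramid (e : nat) (P : set 'rV[R]_e) : Prop :=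
  exists (d : nat) (Q : set 'rV[R]_d) (P' : set 'rV[R]_e),
    [/\ lattice_polytope Q, has_dim Q d, iterated_Pyr Q P' &
        unimod_equiv P' P].

Definition dilate (d : nat) (n : nat) (P : set 'rV[R]_d) : set 'rV[R]_d :=
  [set n%:R *: x | x in P].

Definition is_codeg (d : nat) (P : set 'rV[R]_d) (n : nat) : Prop :=
  let good m := (0 < m)%N /\ interior (dilate m P) `&` @lattice d !=set0 in
  good n /\ forall m, good m -> (n <= m)%N.

(* The default value 0 is never taken on full-dimensional lattice polytopes. *)
Definition codeg (d : nat) (P : set 'rV[R]_d) : nat :=
  xget 0%N [set n | is_codeg P n].

Definition degree (d : nat) (P : set 'rV[R]_d) : int :=
  d.+1%:Z - (codeg P)%:Z.

Definition polar (d : nat) (P : set 'rV[R]_d) : set 'rV[R]_d :=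
  [set y | forall x, P x -> \sum_i x 0 i * y 0 i <= 1].

Definition reflexive_polytope (d : nat) (P : set 'rV[R]_d) : Prop :=
  [/\ lattice_polytope P, has_dim P d, interior P 0 &
      lattice_polytope (polar P)].

Definition Gorenstein (d : nat) (P : set 'rV[R]_d) : Prop :=
  [/\ lattice_polytope P, has_dim P d &
      exists (r : nat) (Q : set 'rV[R]_d),
        [/\ (1 <= r)%N, reflexive_polytope Q & unimod_equiv (dilate r P) Q]].

Definition affinely_independent (d n : nat) (v : 'I_n -> 'rV[R]_d) : Prop :=
  forall a : 'I_n -> R,
    \sum_i a i = 0 -> \sum_i a i *: v i = 0 -> forall i, a i = 0.

(* A simplex is given by its ordered list of vertices; with n vertices its
   dimension is n - 1. *)
Definition simplex_of (d n : nat) (v : 'I_n -> 'rV[R]_d) : set 'rV[R]_d :=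
  conv_hull (range v).

Definition lattice_simplex (d n : nat) (v : 'I_n -> 'rV[R]_d) : Prop :=
  affinely_independent v /\ lattice_polytope (simplex_of v).

Definition Lambda (d n : nat) (v : 'I_n -> 'rV[R]_d) : set 'rV[R]_n :=
  [set x | (forall i, 0 <= x 0 i < 1) /\
     lattice (\sum_i x 0 i *: row_mx (v i) (const_mx 1 : 'rV[R]_1))].

(* The point c/2 of [0,1)^n. *)
Definition half_vec (n : nat) (c : 'rV['F_2]_n) : 'rV[R]_n :=
  \row_i (if c 0 i == 1 then 2^-1 else 0).

End LatticePolytopes.

Definition even_code (n : nat) (C : {vspace 'rV['F_2]_n}) : Prop :=
  forall c, c \in C -> ~~ odd #|[set i | c 0 i != 0]%SET|.

Definition self_complementary (n : nat) (C : {vspace 'rV['F_2]_n}) : Prop :=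
  const_mx 1 \in C.

(* Main.v *)
Require Import Defs.
From HB Require Import structures.
From mathcomp Require Import all_boot all_order all_algebra.
From mathcomp Require Import all_classical all_reals all_analysis.
From mathcomp Require Import perm ring lra zify.

(** Placing the vertices [v i] at height one turns the simplex into the matrix
    [hmat v] with rows [(v i, 1)], and taking barycentric coordinates becomes
    multiplication by the inverse matrix.  The group [Lambda v] records the
    fractional parts of the coordinates of the lattice points [(x, m)].

    From a simplex to a code.  Let [r P] be, up to a lattice isomorphism, a
    reflexive simplex with origin [p], and let [lam] be the coordinates of
    [(p, r)].  The vertices of the polar polytope are explicit dual points, one
    for each facet ([polar_simplex]), and their integrality says that the [i]-th
    coordinate of every lattice point is an integral multiple of [lam i]
    ([Gorenstein_weights]); since the vertex [v i] itself has coordinate one,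
    [lam i] is the inverse of a positive integer.  If that integer were one, the
    [i]-th coordinate would be integral on all lattice points, hence an integral
    affine form vanishing on a facet and equal to one at the opposite vertex, and
    the simplex would be a lattice pyramid ([Lambda0_pyramid]).  So
    [lam i <= 1 / 2] for the [2 s] indices [i].  On the other hand
    [\sum_i lam i = r], and [r >= s] because [p] is an interior lattice point of
    [r P] and the codegree is [s].  Hence every weight is exactly [1 / 2]
    ([Gorenstein_half_weights]): all coordinates of lattice points are
    half-integral, the point [p] contributes the all-one codeword, and the height
    being an integer makes the weights of codewords even ([Lambda_code]).

    From a code to a simplex.  The lattice generated by [Z^n] and the halved
    codewords has a basis, found by a Smith normal form; evenness makes the
    coordinate sum an integral form on this lattice, and it is primitive because
    it is one on the unit vectors, so the basis can be chosen with the coordinate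
    sum as its last coordinate ([even_code_lattice_basis]).  In such a basis the
    unit vectors become points [(v i, 1)], and lattice points have precisely the
    coordinates prescribed by the code ([code_simplex]).  The centre
    [\sum_i v i / 2] is a lattice point since the code is self-complementary; it
    is interior to the [s]-th dilate, and half-integrality makes it the first
    interior lattice point and makes the dual points integral.  The simplex is
    not a pyramid since no coordinate of the all-one codeword vanishes, whereas
    the coordinate of the apex of a pyramid is integral on lattice points
    ([pyramid_Lambda0]). *)

Set Implicit Arguments.
Unset Strict Implicit.
Unset Printing Implicit Defensive.

Import Order.TTheory GRing.Theory Num.Theory.
Import numFieldNormedType.Exports.

Local Open Scope classical_set_scope.
Local Open Scope ring_scope.

(** * Convex hulls *)

Section ConvexHulls.
Variable R : realType.
Implicit Types d e : nat.

Lemma convex_setP d (A : set 'rV[R]_d) :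
  @convex_set R 'rV[R]_d A <->
  forall x y t, A x -> A y -> 0 <= t <= 1 -> A (t *: x + (1 - t) *: y).
Proof.
split=> [cA x y t Ax Ay /andP[t0 t1]|cA x y l].
  by have := cA x y (Itv01 t0 t1); rewrite !inE; apply.
by rewrite !inE => Ax Ay; apply: cA => //; rewrite ge0 le1.
Qed.

Lemma sub_conv_hull d (A : set 'rV[R]_d) : A `<=` conv_hull A.
Proof. exact: sub_smallest. Qed.

Lemma conv_hull_min d (A B : set 'rV[R]_d) :
  @convex_set R 'rV[R]_d B -> A `<=` B -> conv_hull A `<=` B.
Proof. by move=> cB AB; apply: smallest_sub. Qed.

Lemma conv_hull_convex d (A : set 'rV[R]_d) x y t :
  conv_hull A x -> conv_hull A y -> 0 <= t <= 1 ->
  conv_hull A (t *: x + (1 - t) *: y).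
Proof.
move=> Ax Ay t01 B [cB AB]; move/convex_setP : (cB); apply=> //.
- by apply: Ax; split.
- by apply: Ay; split.
Qed.

Lemma conv_hull_sub d (A B : set 'rV[R]_d) :
  A `<=` B -> conv_hull A `<=` conv_hull B.
Proof.
move=> AB; apply: conv_hull_min; last exact: subset_trans (@sub_conv_hull _ _).
by apply/convex_setP => *; exact: conv_hull_convex.
Qed.

Lemma image_conv_hull d e (f : 'rV[R]_d -> 'rV[R]_e) (A : set 'rV[R]_d) :
  (forall x y t, f (t *: x + (1 - t) *: y) = t *: f x + (1 - t) *: f y) ->
  f @` conv_hull A = conv_hull (f @` A).
Proof.
move=> faff; apply/seteqP; split.
  suff AB : conv_hull A `<=` f @^-1` conv_hull (f @` A) by move=> _ [x /AB ? <-].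
  apply: conv_hull_min => [|x Ax]; last by apply: sub_conv_hull; exists x.
  by apply/convex_setP => x y t Ax Ay t01 /=; rewrite faff; exact: conv_hull_convex.
apply: conv_hull_min; last by apply: image_subset; exact: sub_conv_hull.
apply/convex_setP => _ _ t [x Ax <-] [y Ay <-] t01.
by exists (t *: x + (1 - t) *: y); [exact: conv_hull_convex|rewrite faff].
Qed.

(** Removing an extreme point from a convex set leaves a convex set, so a
    generating set that misses an extreme point cannot generate it. *)
Lemma vertex_conv_hull d (A : set 'rV[R]_d) x :
  vertex (conv_hull A) x -> A x.
Proof.
move=> [Hx ext]; apply: contrapT => nAx.
have: (conv_hull A `\ x) x; last by case=> _; apply.
apply: (@conv_hull_min _ A) Hx; last first.
  by move=> y Ay; split; [exact: sub_conv_hull|move=> /= yx; apply: nAx; rewrite -yx].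
apply/convex_setP => y z t [Hy yx] [Hz zx] /andP[t0 t1]; split.
  by apply: conv_hull_convex => //; rewrite t0 t1.
move=> /= E.
have [t00|tn0] := eqVneq t 0.
  by apply: zx; rewrite -E t00 scale0r add0r subr0 scale1r.
have [t11|tn1] := eqVneq t 1.
  by apply: yx; rewrite -E t11 subrr scale0r addr0 scale1r.
have [|/yx//] := ext y z t Hy Hz _ (esym E).
by rewrite !lt_neqAle eq_sym tn0 t0 tn1 t1.
Qed.

(** Peeling off the first point leaves a convex combination after dividing by
    the remaining mass [r]. *)
Lemma conv_hull_sum d n (A : set 'rV[R]_d) (p : 'I_n -> 'rV[R]_d) a :
  (forall i, A (p i)) -> (forall i, 0 <= a i) -> \sum_i a i = 1 ->
  conv_hull A (\sum_i a i *: p i).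
Proof.
elim: n p a => [|n IH] p a Ap a0.
  by rewrite big_ord0 => /eqP; rewrite eq_sym oner_eq0.
rewrite !big_ord_recl => aE; set r := \sum_(i < n) a _ in aE.
have r0 : 0 <= r by apply: sumr_ge0.
have [rz|rn0] := eqVneq r 0.
  rewrite big1 ?addr0 => [|i _].
    by move: aE; rewrite rz addr0 => ->; rewrite scale1r; exact: sub_conv_hull.
  move/eqP: rz; rewrite psumr_eq0// => /allP/(_ i).
  by rewrite mem_index_enum => /(_ isT)/eqP ->; rewrite scale0r.
have -> : \sum_(i < n) a (lift ord0 i) *: p (lift ord0 i) =
   (1 - a ord0) *: \sum_(i < n) (a (lift ord0 i) / r) *: p (lift ord0 i).
  rewrite -aE addrAC subrr add0r scaler_sumr; apply: eq_bigr => i _.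
  by rewrite scalerA mulrC divfK.
apply: conv_hull_convex; first exact: sub_conv_hull.
  apply: IH => // [i|]; first exact: divr_ge0.
  by rewrite -mulr_suml divff.
by rewrite a0 -aE lerDl r0.
Qed.

End ConvexHulls.
(** * Simplices and barycentric coordinates *)

Section Simplices.
Variable R : realType.
Implicit Types d n : nat.

Lemma exists_neq d (i : 'I_(d + 1)) : (0 < d)%N -> exists j, j != i.
Proof.
move=> d0; apply: contrapT => /forallNP ni.
have eqi j : j = i by move: (ni j) => /negP/negPn/eqP.
have : (#|'I_(d + 1)| <= 1)%N by apply/card_le1_eqP => a b _ _; rewrite (eqi a) (eqi b).
by rewrite card_ord addn1 ltnS leqn0 gtn_eqF.
Qed.

(** The embedding of space at height one, where barycentric coordinates become
    linear. *)
Definition homog d (x : 'rV[R]_d) : 'rV[R]_(d + 1) := row_mx x (const_mx 1).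

Definition hmat d n (v : 'I_n -> 'rV[R]_d) : 'M[R]_(n, d + 1) :=
  \matrix_i homog (v i).

Lemma mul_hmat d n (v : 'I_n -> 'rV[R]_d) (a : 'rV[R]_n) :
  a *m hmat v = row_mx (\sum_i a 0 i *: v i) (const_mx (\sum_i a 0 i)).
Proof.
rewrite mulmx_sum_row -[LHS]hsubmxK; congr row_mx; apply/rowP => j.
  rewrite mxE !summxE; apply: eq_bigr => i _.
  by rewrite mxE rowK row_mxEl [RHS]mxE.
rewrite mxE summxE [RHS]mxE; apply: eq_bigr => i _.
by rewrite mxE rowK row_mxEr mxE mulr1.
Qed.

Lemma homog_inj d : injective (@homog d).
Proof. by move=> x y /eq_row_mx[]. Qed.

Lemma homog_affine d (x y : 'rV[R]_d) t :
  homog (t *: x + (1 - t) *: y) = t *: homog x + (1 - t) *: homog y.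
Proof.
rewrite /homog !scale_row_mx add_row_mx; congr row_mx.
by apply/rowP => i; rewrite !mxE; ring.
Qed.

Lemma affinely_independentP d (v : 'I_(d + 1) -> 'rV[R]_d) :
  affinely_independent v <-> hmat v \in unitmx.
Proof.
split=> [vi|vu a a0 av i].
  rewrite -row_free_unit; apply: inj_row_free => a.
  rewrite mul_hmat -[0 in RHS]row_mx0 => /eq_row_mx[av /rowP/(_ 0)].
  by rewrite !mxE => a0; apply/rowP => i; rewrite mxE; apply: vi.
have : (\row_i a i) *m hmat v = 0.
  rewrite mul_hmat.
  under eq_bigr do rewrite mxE.
  under [X in const_mx X]eq_bigr do rewrite mxE.
  by rewrite av a0 -[const_mx 0]/(0 : 'rV_1) row_mx0.
move/(canRL (mulmxK vu)); rewrite mul0mx => /rowP/(_ i).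
by rewrite !mxE.
Qed.

Lemma simplexP d n (v : 'I_n -> 'rV[R]_d) x :
  simplex_of v x <->
  exists2 a : 'rV[R]_n, (forall i, 0 <= a 0 i) & a *m hmat v = homog x.
Proof.
split; last first.
  move=> [a a0]; rewrite mul_hmat => /eq_row_mx[<- /rowP/(_ 0)].
  rewrite !mxE => a1; by apply: conv_hull_sum => // i; exists i.
move: x; apply: conv_hull_min; last first.
  move=> _ [i _ <-]; exists (delta_mx 0 i); first by move=> j; rewrite mxE ler0n.
  by rewrite -rowE rowK.
apply/convex_setP => x y t [a a0 ax] [b b0 bx] /andP[t0 t1].
exists (t *: a + (1 - t) *: b); last by rewrite mulmxDl -!scalemxAl ax bx homog_affine.
by move=> i; rewrite !mxE addr_ge0// mulr_ge0// subr_ge0.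
Qed.

Lemma vertex_simplex d n (v : 'I_n -> 'rV[R]_d) x :
  vertex (simplex_of v) x -> exists i, x = v i.
Proof. by move/vertex_conv_hull => [i _ <-]; exists i. Qed.

Lemma simplex_lattice_polytope d n (v : 'I_n -> 'rV[R]_d) :
  (forall i, lattice (v i)) -> lattice_polytope (simplex_of v).
Proof.
move=> vl; split; last by move=> x /vertex_simplex[i ->].
by exists (range v); split=> //; exact/finite_image/finite_finset.
Qed.

Section FullDimensional.
Variables (d : nat) (v : 'I_(d + 1) -> 'rV[R]_d).
Hypothesis vu : hmat v \in unitmx.

Definition bary (x : 'rV[R]_d) : 'rV[R]_(d + 1) := homog x *m invmx (hmat v).

Lemma bary_hmat x : bary x *m hmat v = homog x.
Proof. by rewrite mulmxKV. Qed.

Lemma hmat_inj (a b : 'rV[R]_(d + 1)) : a *m hmat v = b *m hmat v -> a = b.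
Proof. exact: (can_inj (mulmxK vu)). Qed.

Lemma bary_sum x : \sum_i bary x 0 i = 1.
Proof.
by have := bary_hmat x; rewrite mul_hmat => /eq_row_mx[_ /rowP/(_ 0)]; rewrite !mxE.
Qed.

Lemma sum_bary x : \sum_i bary x 0 i *: v i = x.
Proof. by have := bary_hmat x; rewrite mul_hmat => /eq_row_mx[]. Qed.

Lemma bary_vertex i : bary (v i) = delta_mx 0 i.
Proof. by apply: hmat_inj; rewrite bary_hmat -rowE rowK. Qed.

Lemma bary_affine x y t i :
  bary (t *: x + (1 - t) *: y) 0 i = t * bary x 0 i + (1 - t) * bary y 0 i.
Proof.
rewrite /bary homog_affine mulmxDl -!scalemxAl mxE.
by congr (_ + _); rewrite mxE.
Qed.

Lemma simplex_baryP x : simplex_of v x <-> forall i, 0 <= bary x 0 i.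
Proof.
rewrite simplexP; split=> [[a a0 ax] i|b0]; last by exists (bary x); rewrite ?bary_hmat.
by rewrite /bary -ax mulmxK.
Qed.

(** On a segment through [v i] the other coordinates, being nonnegative, vanish
    at both ends. *)
Lemma vertex_of_simplex i : vertex (simplex_of v) (v i).
Proof.
split=> [|x y t /simplex_baryP x0 /simplex_baryP y0 /andP[t0 t1] E].
  by apply: sub_conv_hull; exists i.
have s0 : 0 < 1 - t by rewrite subr_gt0.
have corner z : (forall j, 0 <= bary z 0 j) ->
    (forall j, j != i -> bary z 0 j = 0) -> z = v i.
  move=> z0 zj; apply: homog_inj; rewrite -!bary_hmat bary_vertex; congr (_ *m _).
  apply/rowP => j; rewrite [RHS]mxE eqxx /=; case: eqVneq => [->|/zj//].
  by rewrite -(bary_sum z) (bigD1 i)//= big1 ?addr0// => k /zj.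
have zero j : j != i -> bary x 0 j = 0 /\ bary y 0 j = 0.
  move=> ji; have := congr1 (fun z => bary z 0 j) E.
  rewrite /= bary_vertex bary_affine mxE eqxx (negPf ji) /= => /esym/eqP.
  rewrite paddr_eq0 ?mulr_ge0 ?(ltW t0) ?(ltW s0)//.
  by rewrite !mulf_eq0 (gt_eqF t0) (gt_eqF s0) => /andP[/eqP-> /eqP->].
by split; apply: corner => // j /zero[].
Qed.

Lemma simplex_has_dim : has_dim (simplex_of v) d.
Proof.
exists 0, fullv; split; last by rewrite dimvf dim_matrix; exact: mul1n.
apply/seteqP; split=> [x _|x _]; first by exists x; rewrite ?add0r//= memvf.
exists (d + 1)%N, v, (fun i => bary x 0 i).
by split=> [i||]; [apply: sub_conv_hull; exists i|exact: bary_sum|rewrite sum_bary].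
Qed.

End FullDimensional.
End Simplices.
(** * Interior points and polar duality of simplices *)

Section DotProduct.
Variables (R : realType) (d : nat).
Implicit Types x y : 'rV[R]_d.

Definition dot x y := \sum_k x 0 k * y 0 k.

Lemma dotE x y : dot x y = (x *m y^T) 0 0.
Proof. by rewrite mxE; apply: eq_bigr => k _; rewrite mxE. Qed.

Lemma dotC x y : dot x y = dot y x.
Proof. by apply: eq_bigr => k _; rewrite mulrC. Qed.

Lemma dotDl x1 x2 y : dot (x1 + x2) y = dot x1 y + dot x2 y.
Proof. by rewrite !dotE mulmxDl mxE. Qed.

Lemma dotZl a x y : dot (a *: x) y = a * dot x y.
Proof. by rewrite !dotE -scalemxAl mxE. Qed.

Lemma dot_suml n (a : 'I_n -> R) (p : 'I_n -> 'rV[R]_d) y :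
  dot (\sum_i a i *: p i) y = \sum_i a i * dot (p i) y.
Proof.
rewrite dotE mulmx_suml summxE; apply: eq_bigr => i _.
by rewrite -dotE dotZl.
Qed.

Lemma dot_sumr n (a : 'I_n -> R) (p : 'I_n -> 'rV[R]_d) x :
  dot x (\sum_i a i *: p i) = \sum_i a i * dot x (p i).
Proof. by rewrite dotC dot_suml; apply: eq_bigr => i _; rewrite dotC. Qed.

End DotProduct.

Section Duality.
Variable R : realType.
Variables (d : nat) (v : 'I_(d + 1) -> 'rV[R]_d).
Hypothesis vu : hmat v \in unitmx.

Let N := invmx (hmat v).

Lemma baryE x i :
  bary v x 0 i = bary v 0 0 i + \sum_k x 0 k * N (lshift 1 k) i.
Proof.
rewrite /bary !mxE !big_split_ord /=.
under eq_bigr do rewrite row_mxEl.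
under [X in _ + X = _]eq_bigr do rewrite row_mxEr.
under [X in _ = X + _ + _]eq_bigr do rewrite row_mxEl mxE mul0r.
under [X in _ = _ + X + _]eq_bigr do rewrite row_mxEr.
by rewrite [X in _ = X + _ + _]big1// add0r addrC.
Qed.

Lemma bary_continuous i : continuous (fun x => bary v x 0 i).
Proof.
have -> : (fun x => bary v x 0 i) = (fun y : 'rV[R]_d =>
  bary v 0 0 i + \sum_k y 0 k * N (lshift 1 k) i).
  by apply/funext => y; rewrite baryE.
move=> x; apply: continuousD; first exact: cst_continuous.
move: x; apply: continuous_big => [|k _ x]; first exact: add_continuous.
by apply: continuousM; [exact: coord_continuous|exact: cst_continuous].
Qed.

(** From an interior point one can still move a little away from any vertex,
    which would make a vanishing barycentric coordinate negative. *)
Lemma interior_simplexP x :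
  interior (simplex_of v) x <-> forall i, 0 < bary v x 0 i.
Proof.
split=> [Sx i|b0]; last first.
  have : \forall y \near x, forall i, 0 < bary v y 0 i.
    apply: (@filter_forall _ _ (fun i y => 0 < bary v y 0 i) (nbhs x)) => i.
    exact: (bary_continuous (lt_nbhsr (b0 i))).
  by apply: filterS => y y0; apply/simplex_baryP => // i; exact: ltW.
pose g (t : R) := x + t *: (x - v i).
have gE t : g t = (1 + t) *: x + (1 - (1 + t)) *: v i.
  by rewrite /g scalerDl scale1r opprD addNKr scaleNr -addrA scalerBr.
have gc : continuous g.
  move=> t; apply: (@cvgD R 'rV[R]_d R (nbhs t) _ (fun=> x) (fun t => t *: (x - v i))).
    exact: cst_continuous.
  exact: scalel_continuous.
have g0 : g 0 = x by rewrite /g scale0r addr0.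
move: (gc 0 (simplex_of v)); rewrite /= g0 => /(_ Sx)/nbhs_ballP[e /= e0 eS].
have e2 : 0 < e / 2 by rewrite divr_gt0.
have /(simplex_baryP vu)/(_ i) : simplex_of v (g (e / 2)).
  by apply: eS; rewrite /ball /= sub0r normrN gtr0_norm//; lra.
rewrite gE bary_affine bary_vertex// [delta_mx _ _ _ _]mxE !eqxx /= mulr1 => H.
rewrite ltNge; apply/negP => b0.
suff : (1 + e / 2) * bary v x 0 i <= 0 by lra.
by rewrite mulr_ge0_le0//; lra.
Qed.

(** The facet of the simplex opposite to vertex [i] lies on the hyperplane
    [<x, dual i> = 1]. *)
Definition dual i : 'rV[R]_d := \row_k (- N (lshift 1 k) i / bary v 0 0 i).

Hypothesis b0 : forall i, 0 < bary v 0 0 i.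

Lemma bary_dual x i :
  bary v x 0 i = bary v 0 0 i * (1 - dot x (dual i)).
Proof.
rewrite baryE mulrBr mulr1 mulr_sumr -sumrN; congr (_ + _).
apply: eq_bigr => k _; rewrite [dual i 0 k]mxE.
by field; rewrite gt_eqF.
Qed.

Lemma vertex_dual i j : dot (v j) (dual i) = 1 - (i == j)%:R / bary v 0 0 i.
Proof.
have := bary_dual (v j) i.
rewrite bary_vertex// [delta_mx _ _ _ _]mxE eqxx /= eq_sym => ->.
by field; rewrite gt_eqF.
Qed.

Lemma dot_ext (y z : 'rV[R]_d) : (forall j, dot (v j) y = dot (v j) z) -> y = z.
Proof.
move=> yz.
have yzT x : dot x y = dot x z.
  rewrite -(sum_bary vu x) !dot_suml.
  by apply: eq_bigr => j _; rewrite yz.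
apply/rowP => k; have := yzT (delta_mx 0 k).
by rewrite !dotE -!rowE !mxE.
Qed.

(** Pairing with a vertex of the primal simplex isolates one coefficient of an
    affine combination of the dual points. *)
Lemma dot_sum_dual (a : 'I_(d + 1) -> R) j :
  dot (v j) (\sum_i a i *: dual i) = \sum_i a i - a j / bary v 0 0 j.
Proof.
rewrite dot_sumr; under eq_bigr do rewrite vertex_dual mulrBr mulr1.
rewrite sumrB [X in _ - X](bigD1 j)//= [X in _ - (_ + X)]big1 => [|i /negPf ->].
  by rewrite eqxx addr0 mul1r.
by rewrite mul0r mulr0.
Qed.

Lemma dot_sum_vertex (a : 'I_(d + 1) -> R) i :
  dot (\sum_j a j *: v j) (dual i) = \sum_j a j - a i / bary v 0 0 i.
Proof.
rewrite dot_suml; under eq_bigr do rewrite vertex_dual mulrBr mulr1.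
rewrite sumrB [X in _ - X](bigD1 i)//= [X in _ - (_ + X)]big1 => [|j].
  by rewrite eqxx addr0 mul1r.
by rewrite eq_sym => /negPf ->; rewrite mul0r mulr0.
Qed.

Lemma dual_unit : hmat dual \in unitmx.
Proof.
apply/affinely_independentP => a a0 av j.
have := dot_sum_dual a j; rewrite av dotC a0 sub0r [dot _ _]big1 => [|k _].
  by move=> /esym/eqP; rewrite oppr_eq0 mulf_eq0 invr_eq0 (gt_eqF (b0 j)) orbF => /eqP.
by rewrite mxE mul0r.
Qed.

(** The slacks [1 - <v j, y>], weighted by the coordinates of the origin, are the
    barycentric coordinates of [y] in the dual simplex. *)
Lemma polar_simplex : polar (simplex_of v) = simplex_of dual.
Proof.
apply/seteqP; split=> y; last first.
  move/simplexP=> [a a0]; rewrite mul_hmat => /eq_row_mx[<- /rowP/(_ 0)].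
  rewrite !mxE => a1 x /(simplex_baryP vu) x0.
  rewrite -/(dot _ _) dot_sumr -[leRHS]a1; apply: ler_sum => i _.
  rewrite -[leRHS]mulr1 ler_wpM2l//.
  have := x0 i; rewrite bary_dual pmulr_rge0//; lra.
move=> py.
pose m j := (1 - dot (v j) y) * bary v 0 0 j.
have m0 j : 0 <= m j.
  apply: mulr_ge0; last exact: ltW.
  rewrite subr_ge0; apply: py.
  by apply: sub_conv_hull; exists j.
have m1 : \sum_j m j = 1.
  rewrite /m; under eq_bigr do rewrite mulrBl mul1r mulrC.
  rewrite sumrB bary_sum// -[X in _ - X]dot_suml sum_bary//.
  by rewrite [dot _ _]big1 ?subr0// => k _; rewrite mxE mul0r.
have -> : y = \sum_i m i *: dual i.
  apply: dot_ext => j; rewrite dot_sum_dual m1 /m mulfK ?gt_eqF//; ring.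
exact: conv_hull_sum.
Qed.

End Duality.
(** * Integral lattices and binary codes *)

Lemma F2E (a : 'F_2) : a = (a != 0)%:R.
Proof. by apply: val_inj; case: a => [[|[|]]]. Qed.

Section Lattices.

(** A column whose entries have greatest common divisor one is the last column
    of a unimodular matrix: its Smith form is a single unit. *)
Lemma unimodular_completion d (u : 'cV[int]_(d + 1)) (x : 'rV[int]_(d + 1)) :
  x *m u = 1%:M ->
  exists2 U : 'M[int]_(d + 1), U \in unitmx & U *m delta_mx (rshift d 0) 0 = u.
Proof.
have [L Lu [T Tu [s _ ->]]] := int_Smith_normal_form u.
pose i0 : 'I_(d + 1) := cast_ord (esym (addn1 d)) ord0.
(* [c] is, up to sign, the greatest common divisor of the entries of [u]. *)
pose c := s`_0 * T 0 0.
have uE : L *m (\matrix_(i, j) (s`_i *+ (i == j :> nat))) *m T =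
    c *: (L *m delta_mx i0 0).
  rewrite -mulmxA scalemxAr; congr (_ *m _); apply/matrixP => i j.
  rewrite !mxE big_ord1 !mxE !ord1 eqxx andbT /c /=.
  rewrite (_ : (i == i0) = (i == 0 :> nat)) //.
  by case: eqP => [->|_]; rewrite ?mulr1 // mul0r mulr0.
rewrite uE => xu.
have cu : c \is a GRing.unit.
  pose y : 'M[int]_1 := x *m (L *m delta_mx i0 0).
  have cy : c * y 0 0 = 1.
    have := congr1 (fun M : 'M[int]_1 => M 0 0) xu.
    by rewrite -scalemxAr /= [LHS]mxE [RHS]mxE.
  by apply/unitrP; exists (y 0 0); rewrite mulrC.
exists (c *: (L *m tperm_mx i0 (rshift d 0))).
  by rewrite unitmxZ// unitmx_mul Lu unitmx_perm.
rewrite -scalemxAl; congr (_ *: _); rewrite -mulmxA; congr (_ *m _).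
rewrite -row_permE; apply/matrixP => i j; rewrite !mxE.
by rewrite -{2}(tpermL i0 (rshift d 0)) (inj_eq perm_inj).
Qed.

Lemma det_unimodular n (U : 'M[int]_n) : U \in unitmx <-> \det U = 1 \/ \det U = -1.
Proof.
rewrite unitmxE; split=> [|[]->//].
by move=> /orP[]/eqP; [left|right].
Qed.

(** Twice the lattice spanned by [Z^n] and the halved codewords consists of the
    integral vectors reducing to codewords; the Smith form of a generating
    matrix of it yields a square basis matrix [B]. *)
Lemma code_lattice_basis n (C : {vspace 'rV['F_2]_n}) :
  exists X B : 'M[int]_n, X *m B = 2%:M /\
    forall x : 'rV[int]_n, map_mx intr x \in C <-> exists z, x = z *m B.
Proof.
pose m := #|{: 'rV['F_2]_n}|.
(* Each codeword gives a row, any other index a zero row; the rows of [2 I]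
   account for the integral vectors reducing to zero. *)
pose w (i : 'I_m) : 'rV['F_2]_n :=
  if enum_val i \in C then enum_val i else 0.
have wC i : w i \in C by rewrite /w; case: ifP => // _; exact: mem0v.
pose lift (c : 'rV['F_2]_n) := map_mx (fun a : 'F_2 => (a : nat)%:Z) c.
pose G : 'M[int]_(n + m, n) := col_mx 2%:M (\matrix_i lift (w i)).
have liftK (a : 'F_2) : intr (a : nat)%:Z = a by rewrite -pmulrn natr_Zp.
have GC z : map_mx intr (z *m G) \in C.
  rewrite map_mxM /G map_col_mx map_scalar_mx rmorph_nat (pchar_Fp_0 (isT : prime 2)).
  rewrite -[map_mx intr z]hsubmxK mul_row_col raddf0 mulmx0 add0r.
  rewrite mulmx_sum_row; apply: memv_suml => i _; apply: memvZ.
  rewrite (_ : row i _ = w i) //; apply/rowP => j.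
  by rewrite !mxE; exact: liftK.
have CG x : map_mx intr x \in C -> exists z, x = z *m G.
  move=> xC; set c := map_mx intr x in xC.
  exists (row_mx (\row_j (divz (x 0 j - (c 0 j : nat)%:Z) 2)) (delta_mx 0 (enum_rank c))).
  rewrite mul_row_col mul_mx_scalar -rowE rowK /w enum_rankK xC.
  apply/rowP => j; rewrite !mxE mulrC divzK ?subrK//.
  by rewrite (dvdz_pcharf (pchar_Fp (isT : prime 2))) rmorphB /= liftK subr_eq0.
have [P Pu [T Tu [s _ GE]]] := int_Smith_normal_form G.
pose B := usubmx (\matrix_(i, j) (s`_i *+ (i == j :> nat)) : 'M[int]_(n + m, n)) *m T.
have GB : G = P *m col_mx B 0.
  rewrite GE -mulmxA; congr (_ *m _).
  rewrite -[X in X *m T]vsubmxK mul_col_mx; congr col_mx.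
  rewrite (_ : dsubmx _ = 0) ?mul0mx//; apply/matrixP => i j; rewrite !mxE /=.
  by rewrite gtn_eqF// ltn_addr.
have BG z : exists z', z *m B = z' *m G.
  exists (row_mx z 0 *m invmx P).
  by rewrite GB mulmxA mulmxKV// mul_row_col mul0mx addr0.
have GB' k (z : 'M[int]_(k, n + m)) : z *m G = lsubmx (z *m P) *m B.
  by rewrite GB mulmxA -[X in X *m _]hsubmxK mul_row_col mulmx0 addr0.
exists (lsubmx (row_mx 1%:M 0 *m P)), B; split=> [|x].
  by rewrite -GB' /G mul_row_col mul1mx mul0mx addr0.
split=> [/CG[z ->]|[z ->]]; first by exists (lsubmx (z *m P)); rewrite GB'.
by have [z' ->] := BG _ z.
Qed.

(** In an even code the rows of [B] have even sums, and the half sums form a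
    column to which [unimodular_completion] applies. *)
Lemma even_code_lattice_basis d (C : {vspace 'rV['F_2]_(d + 1)}) :
  even_code C ->
  exists X B : 'M[int]_(d + 1),
    [/\ X *m B = 2%:M, X *m delta_mx (rshift d 0) 0 = const_mx 1 :> 'cV_(d + 1) &
      forall x : 'rV[int]_(d + 1), map_mx intr x \in C <-> exists z, x = z *m B].
Proof.
move=> evC; have [X [B [XB BC]]] := code_lattice_basis C.
pose one : 'cV[int]_(d + 1) := const_mx 1.
have sum2 i : (B *m one) i 0 \in dvdz 2.
  have /evC : map_mx intr (row i B) \in C.
    by apply/BC; exists (delta_mx 0 i); rewrite -rowE.
  set S := [set j | _]%SET => evS.
  rewrite (dvdz_pcharf (pchar_Fp (isT : prime 2))) mxE rmorph_sum /=.
  rewrite (eq_bigr (fun j => (j \in S)%:R)) => [|j _].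
    by rewrite -natr_sum -big_mkcond /= sum1_card -Fp_nat_mod// modn2 (negPf evS).
  by rewrite mxE mulr1 inE !mxE; exact: F2E.
pose u : 'cV[int]_(d + 1) := \col_i divz ((B *m one) i 0) 2.
have B1 : B *m one = 2 *: u.
  by apply/colP => i; rewrite [RHS]mxE [u i 0]mxE mulrC divzK.
have Xu : X *m u = one.
  have : 2 *: (X *m u) = 2 *: one by rewrite scalemxAr -B1 mulmxA XB mul_scalar_mx.
  move/colP => E; apply/colP => i.
  by have := E i; rewrite mxE [RHS]mxE => /(mulfI (isT : 2 != 0 :> int)).
have /unimodular_completion[U Uu Ue] : row (rshift d 0) X *m u = 1%:M.
  by rewrite -row_mul Xu; apply/matrixP => i j; rewrite !mxE !ord1.
exists (X *m U), (invmx U *m B); split.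
- by rewrite mulmxA mulmxK.
- by rewrite -mulmxA Ue.
move=> x; rewrite BC; split=> -[z ->].
  by exists (z *m U); rewrite -mulmxA mulKVmx.
by exists (z *m invmx U); rewrite mulmxA.
Qed.

End Lattices.
(** * Affine images, dilates and lattice points *)

Section AffineImages.
Variable R : realType.
Variable d : nat.
Implicit Types (U : 'M[R]_d) (w x : 'rV[R]_d).

(** The matrix acting at height one as [x |-> x U + w]. *)
Definition aff_mx U w : 'M[R]_(d + 1) := block_mx U 0 w 1%:M.

Lemma row_aff_mx U w x (m : R) :
  row_mx x (const_mx m) *m aff_mx U w = row_mx (x *m U + m *: w) (const_mx m).
Proof.
rewrite mul_row_block mulmx0 mulmx1 add0r; congr (row_mx (_ + _) _).
by apply/rowP => j; rewrite !mxE big_ord1 !mxE.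
Qed.

Lemma hmat_aff n (v : 'I_n -> 'rV[R]_d) U w :
  hmat (fun i => v i *m U + w) = hmat v *m aff_mx U w.
Proof. by apply/row_matrixP => i; rewrite row_mul !rowK row_aff_mx scale1r. Qed.

Lemma aff_mx_unit U w : U \in unitmx -> aff_mx U w \in unitmx.
Proof. by rewrite !unitmxE det_lblock det1 mulr1. Qed.

Lemma image_aff_conv_hull (A : set 'rV[R]_d) U w :
  [set x *m U + w | x in conv_hull A] = conv_hull [set x *m U + w | x in A].
Proof.
rewrite image_conv_hull// => x y t.
rewrite mulmxDl -!scalemxAl !scalerDr addrACA; congr (_ + _).
by rewrite -scalerDl addrC subrK scale1r.
Qed.

Lemma image_aff_simplex n (v : 'I_n -> 'rV[R]_d) U w :
  [set x *m U + w | x in simplex_of v] = simplex_of (fun i => v i *m U + w).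
Proof. by rewrite /simplex_of image_aff_conv_hull image_comp. Qed.

Lemma dilate_simplex n (v : 'I_n -> 'rV[R]_d) m :
  dilate m (simplex_of v) = simplex_of (fun i => m%:R *: v i).
Proof.
rewrite /dilate /simplex_of image_conv_hull ?image_comp// => x y t.
by rewrite scalerDr !scalerA ![_ * m%:R]mulrC.
Qed.

Lemma hmat_dilate n (v : 'I_n -> 'rV[R]_d) (m : R) :
  hmat (fun i => m *: v i) = hmat v *m aff_mx m%:M 0.
Proof.
by rewrite -hmat_aff; congr hmat; apply/funext => i; rewrite addr0 mul_mx_scalar.
Qed.

(** The coordinates are those of the point at height [m], so that they can be
    compared for lattice points in different dilates. *)
Lemma dilate_interiorP (v : 'I_(d + 1) -> 'rV[R]_d) m x :
  hmat v \in unitmx -> (0 < m)%N ->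
  interior (dilate m (simplex_of v)) x <->
  exists2 a : 'rV[R]_(d + 1), (forall i, 0 < a 0 i) &
    a *m hmat v = row_mx x (const_mx m%:R).
Proof.
move=> vu m0; have mR : 0 < m%:R :> R by rewrite ltr0n.
have mvu : hmat (fun i => m%:R *: v i) \in unitmx.
  rewrite hmat_dilate unitmx_mul vu aff_mx_unit//.
  by rewrite unitmxE det_scalar unitrX// unitfE gt_eqF.
rewrite dilate_simplex interior_simplexP//; split=> [b0|[a a0 ax] i].
  exists (m%:R *: bary (fun i => m%:R *: v i) x).
    by move=> i; rewrite mxE mulr_gt0.
  rewrite mul_hmat; congr (row_mx _ (const_mx _)).
    rewrite -[RHS](sum_bary mvu); apply: eq_bigr => i _.
    by rewrite mxE scalerA mulrC.
  under eq_bigr do rewrite mxE.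
  by rewrite -mulr_sumr bary_sum// mulr1.
suff -> : bary (fun i => m%:R *: v i) x = m%:R^-1 *: a.
  by rewrite mxE mulr_gt0 ?invr_gt0.
apply: (hmat_inj mvu); rewrite bary_hmat// -scalemxAl hmat_dilate mulmxA ax.
rewrite row_aff_mx scaler0 addr0 scale_row_mx mul_mx_scalar scalerA mulVf ?gt_eqF//.
rewrite scale1r; congr row_mx; apply/rowP => j.
by rewrite !mxE mulVf// gt_eqF.
Qed.

End AffineImages.

Section LatticePoints.
Variable R : realType.

Lemma latticeP d (x : 'rV[R]_d) : lattice x <-> exists z, x = map_mx intr z.
Proof.
split=> [xi|[z ->] i]; last by rewrite mxE.
exists (\row_i Num.floor (x 0 i)); apply/rowP => i; rewrite !mxE.
by rewrite floorK.
Qed.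

Lemma lattice_mul d e (x : 'rV[R]_d) (U : 'M[int]_(d, e)) :
  lattice x -> lattice (x *m map_mx intr U).
Proof. by move=> /latticeP[z ->]; apply/latticeP; exists (z *m U); rewrite map_mxM. Qed.

Lemma latticeD d (x y : 'rV[R]_d) : lattice x -> lattice y -> lattice (x + y).
Proof. by move=> xi yi i; rewrite mxE rpredD. Qed.

Lemma latticeN d (x : 'rV[R]_d) : lattice x -> lattice (- x).
Proof. by move=> xi i; rewrite mxE rpredN. Qed.

Lemma lattice_row_mx d e (x : 'rV[R]_d) (y : 'rV[R]_e) :
  lattice (row_mx x y) <-> lattice x /\ lattice y.
Proof.
split=> [xy|[xi yi] i]; last first.
  by case: (split_ordP i) => j ->; rewrite ?row_mxEl ?row_mxEr.
split=> i; first by have := xy (lshift e i); rewrite row_mxEl.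
by have := xy (rshift d i); rewrite row_mxEr.
Qed.

Lemma lattice_homog d (x : 'rV[R]_d) : lattice x -> lattice (homog x).
Proof. by move=> xi; apply/lattice_row_mx; split=> // i; rewrite mxE. Qed.

Lemma dot_int d (x y : 'rV[R]_d) : lattice x -> lattice y -> dot x y \is a Num.int.
Proof. by move=> xi yi; apply: rpred_sum => i _; exact: rpredM. Qed.

Lemma lattice_comb d n (a : 'rV[R]_n) (v : 'I_n -> 'rV[R]_d) :
  lattice a -> (forall i, lattice (v i)) -> lattice (a *m hmat v).
Proof.
move=> ai vi j; rewrite mxE; apply: rpred_sum => i _; apply: rpredM => //.
by rewrite mxE; exact: lattice_homog.
Qed.

Lemma unimodular_inv d (U : 'M[int]_d) :
  U \in unitmx -> map_mx intr U *m map_mx intr (invmx U) = 1%:M :> 'M[R]_d.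
Proof. by move=> Uu; rewrite -map_mxM mulmxV// map_scalar_mx rmorph1. Qed.

Lemma unimodular_unit d (U : 'M[int]_d) :
  U \in unitmx -> map_mx intr U \in @unitmx R d.
Proof. by move=> /unimodular_inv/mulmx1_unit[]. Qed.

Lemma LambdaP d n (v : 'I_n -> 'rV[R]_d) x :
  Lambda v x <-> (forall i, 0 <= x 0 i < 1) /\ lattice (x *m hmat v).
Proof.
suff -> : x *m hmat v = \sum_i x 0 i *: row_mx (v i) (const_mx 1) by [].
by rewrite mulmx_sum_row; apply: eq_bigr => i _; rewrite rowK.
Qed.

Lemma Lambda_frac d n (v : 'I_n -> 'rV[R]_d) (a : 'rV[R]_n) :
  (forall i, lattice (v i)) -> lattice (a *m hmat v) ->
  Lambda v (\row_i (a 0 i - (Num.floor (a 0 i))%:~R)).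
Proof.
move=> vi av; apply/LambdaP; split=> [i|].
  by rewrite mxE subr_ge0 floor_le ltrBlDl -intrD1 floorD1_gt.
rewrite (_ : \row_i _ = a - map_mx intr (\row_i Num.floor (a 0 i))).
  rewrite mulmxBl; apply: latticeD => //; apply: latticeN.
  by apply: lattice_comb => //; apply/latticeP; eexists.
by apply/rowP => i; rewrite !mxE.
Qed.

Lemma int01_eq0 (x : R) : x \is a Num.int -> 0 <= x < 1 -> x = 0.
Proof.
move=> /intrP[n ->]; rewrite ler0z ltrz1 => /andP[].
by case: n => [[|]|].
Qed.

End LatticePoints.
(** * Lattice pyramids *)

Section Pyramids.
Variable R : realType.

(** The last coordinate separates the apex of the outermost pyramid from its
    base; an integral linear form is all that survives a change of dimension
    and of lattice basis. *)
Lemma iterated_Pyr_form d (Q : set 'rV[R]_d) e (P : set 'rV[R]_e) :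
  iterated_Pyr Q P ->
  exists (A : set 'rV[R]_e) (x0 : 'rV[R]_e) (l : 'cV[int]_e),
    [/\ P = conv_hull (A `|` [set x0]), forall x, A x -> x *m map_mx intr l = 0 &
        x0 *m map_mx intr l = 1%:M].
Proof.
have PyrP k (B : set 'rV[R]_k) :
    exists (A : set 'rV[R]_(k + 1)) x0 (l : 'cV[int]_(k + 1)),
    [/\ Pyr B = conv_hull (A `|` [set x0]), forall x, A x -> x *m map_mx intr l = 0 &
        x0 *m map_mx intr l = 1%:M].
  exists [set row_mx x 0 | x in B], (row_mx 0 (const_mx 1)), (col_mx 0 1%:M).
  split=> // [_ [x _ <-]|]; rewrite map_col_mx mul_row_col map_scalar_mx rmorph1.
    by rewrite raddf0 mulmx0 mul0mx addr0.
  by rewrite mul0mx add0r mulmx1; apply/matrixP => i j; rewrite !mxE !ord1.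
by case=> *; exact: PyrP.
Qed.

(** The vertices of a pyramid other than its apex lie in the kernel of an
    integral affine form taking the value one at the apex; that form is the
    barycentric coordinate of the apex. *)
Lemma pyramid_Lambda0 d (v : 'I_(d + 1) -> 'rV[R]_d) :
  hmat v \in unitmx -> lattice_pyramid (simplex_of v) ->
  exists i, forall x, Lambda v x -> x 0 i = 0.
Proof.
move=> vu [k [Q [P' [_ _ /iterated_Pyr_form[A [x0 [l [PE Al x0l]]]]]]]].
move=> [U [w [/det_unimodular Uu wl]]]; rewrite PE image_aff_conv_hull => vE.
pose f x := x *m map_mx intr U + w.
pose l1 := invmx U *m l.
pose c := - (w *m map_mx intr l1).
pose L : 'cV[R]_(d + 1) := col_mx (map_mx intr l1) c.
have fL x : homog (f x) *m L = x *m map_mx intr l.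
  rewrite mul_row_col (_ : const_mx 1 = 1%:M); last first.
    by apply/matrixP => i j; rewrite !mxE !ord1.
  rewrite mul1mx mulmxDl addrK /l1 map_mxM mulmxA -[x *m _ *m _]mulmxA.
  by rewrite unimodular_inv// mulmx1.
have vertexL j : v j = f x0 \/ homog (v j) *m L = 0.
  have := vertex_of_simplex vu j; rewrite vE => /vertex_conv_hull[x [Ax|->] <-].
    by right; rewrite fL Al.
  by left.
have [i vi] : exists i, v i = f x0.
  apply: contrapT => /forallNP nv.
  have : hmat v *m L = 0.
    apply/row_matrixP => j; rewrite row_mul rowK row0.
    by case: (vertexL j) => // /nv.
  move=> /(congr1 (mulmx (bary v (f x0)))).
  rewrite mulmxA bary_hmat// fL x0l mulmx0 => /matrixP/(_ 0 0)/eqP.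
  by rewrite !mxE eqxx oner_eq0.
have vL : hmat v *m L = delta_mx i 0.
  apply/row_matrixP => j; rewrite row_mul rowK.
  have -> : row j (delta_mx i 0 : 'cV[R]_(d + 1)) = (j == i)%:R%:M.
    by apply/matrixP => a b; rewrite !mxE !ord1 andbT.
  case: eqVneq => [->|ji]; first by rewrite vi fL x0l.
  rewrite raddf0; case: (vertexL j) => // vj.
  have := bary_vertex vu j; rewrite vj -vi bary_vertex// => /rowP/(_ i)/eqP.
  by rewrite !mxE !eqxx (eq_sym i j) (negPf ji) /= oner_eq0.
exists i => x /LambdaP[x01 xl]; apply: int01_eq0 => //.
have -> : x 0 i = (x *m hmat v *m L) 0 0 by rewrite -mulmxA vL -colE mxE.
rewrite -[x *m _]hsubmxK mul_row_col mxE.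
have [xl1 xl2] : lattice (lsubmx (x *m hmat v)) /\ lattice (rsubmx (x *m hmat v)).
  by apply/lattice_row_mx; rewrite hsubmxK.
apply: rpredD; first exact: lattice_mul.
rewrite mxE big_ord1 rpredM// /c mxE rpredN; exact: lattice_mul.
Qed.

(** Conversely a barycentric coordinate that is integral on the lattice splits
    off a coordinate axis pointing from the opposite facet to the apex. *)
Lemma Lambda0_pyramid d (v : 'I_(d + 1) -> 'rV[R]_d) i :
  (0 < d)%N -> hmat v \in unitmx -> (forall j, lattice (v j)) ->
  (forall x, Lambda v x -> x 0 i = 0) -> lattice_pyramid (simplex_of v).
Proof.
case: d v i => // d; rewrite -[d.+1]addn1 => v i _ vu vl Li.
have [j0 j0i] : exists j0, j0 != i by apply: exists_neq; rewrite addn1.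
have coord_int (z : 'rV[R]_(d + 1 + 1)) :
    lattice z -> (z *m invmx (hmat v)) 0 i \is a Num.int.
  move=> zl; set a := z *m _.
  have := @Lambda_frac R _ _ v a vl; rewrite mulmxKV// => /(_ zl)/Li.
  by rewrite mxE => /eqP; rewrite subr_eq0 => /eqP->.
have [n nE] : exists n : 'cV[int]_(d + 1 + 1), col i (invmx (hmat v)) = map_mx intr n.
  exists (\col_k Num.floor (invmx (hmat v) k i)); apply/colP => k; rewrite !mxE floorK//.
  have := coord_int (delta_mx 0 k); rewrite -rowE mxE; apply => j.
  by rewrite mxE.
have homn x : homog x *m map_mx intr n = (bary v x 0 i)%:M.
  rewrite -nE colE mulmxA -/(bary v x) -colE.
  by apply/matrixP => a b; rewrite !mxE !ord1 eqxx.
pose u := usubmx n.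
have diff x y : (x - y) *m map_mx intr u = (bary v x 0 i - bary v y 0 i)%:M.
  rewrite rmorphB /= -!homn -mulmxBl -[n]vsubmxK map_col_mx /homog.
  by rewrite opp_row_mx add_row_mx subrr mul_row_col mul0mx addr0.
have [V [Vu Vl]] : exists V : 'M[int]_(d + 1), V \in unitmx /\
    V *m delta_mx (rshift d 0) 0 = u.
  have /latticeP[z zE] : lattice (v i - v j0) by apply/latticeD/latticeN.
  have zu : z *m u = 1%:M.
    have := diff (v i) (v j0); rewrite zE -map_mxM !bary_vertex//.
    rewrite [delta_mx _ _ _ _]mxE [delta_mx _ _ _ _]mxE !eqxx eq_sym (negPf j0i) /= subr0.
    move=> zu; have /matrixP E : map_mx intr (z *m u) = map_mx intr 1%:M :> 'M[R]_1.
      by rewrite zu map_scalar_mx rmorph1.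
    apply/matrixP => a b; apply: (@intr_inj R).
    by have := E a b; rewrite ![map_mx _ _ _ _]mxE.
  by have [V Vu Ve] := unimodular_completion zu; exists V.
pose w : 'rV[R]_(d + 1) := row_mx 0 (const_mx 1) - v i *m map_mx intr V.
pose f x := x *m map_mx intr V + w.
pose v' j := f (v j).
have wl : lattice w.
  apply: latticeD; last by apply: latticeN; apply: lattice_mul.
  by apply/lattice_row_mx; split=> k; rewrite mxE.
have v'l j : lattice (v' j) by apply: latticeD => //; apply: lattice_mul.
have v'u : hmat v' \in unitmx.
  by rewrite hmat_aff unitmx_mul vu aff_mx_unit// unimodular_unit.
have v'i : v' i = row_mx 0 (const_mx 1) by rewrite /v' /f /w addrC subrK.
have v'r j : rsubmx (v' j) = (j == i)%:R%:M.
  have rlast (y : 'rV[R]_(d + 1)) : rsubmx y = y *m map_mx intr (delta_mx (rshift d 0) 0).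
    by rewrite map_delta_mx -colE; apply/matrixP => a b; rewrite !mxE !ord1.
  rewrite rlast /v' /f /w addrCA -mulmxBl mulmxDl -rlast row_mxKr.
  rewrite -mulmxA -map_mxM Vl diff !bary_vertex//.
  rewrite [delta_mx _ _ _ _]mxE [delta_mx _ _ _ _]mxE !eqxx /= (eq_sym i j).
  by apply/matrixP => a b; rewrite !mxE !ord1 eqxx !mulr1n addrC subrK.
pose q j := lsubmx (v' j).
pose A := q @` [set j | j != i].
have v'q j : j != i -> v' j = row_mx (q j) 0.
  by move=> ji; rewrite -[v' j]hsubmxK v'r (negPf ji) raddf0.
exists d, (conv_hull A), (Pyr (conv_hull A)); split.
- split; first by exists A; split=> //; exact/finite_image/finite_finset.
  move=> _ /vertex_conv_hull[j _ <-].
  by have := v'l j; rewrite -[v' j]hsubmxK => /lattice_row_mx[].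
- exists 0, fullv; split; last by rewrite dimvf dim_matrix; exact: mul1n.
  apply/seteqP; split=> [x _|x _]; first by exists x; rewrite ?add0r//= memvf.
  pose a := bary v' (row_mx x 0) 0.
  have xE : \sum_j a j *: v' j = row_mx x 0 by exact: sum_bary.
  have ai : a i = 0.
    have /matrixP/(_ 0 0) : rsubmx (\sum_j a j *: v' j) = 0 by rewrite xE row_mxKr.
    rewrite linear_sum /= summxE (bigD1 i)//= big1 => [|j ji].
      by rewrite linearZ /= v'r eqxx !mxE mulr1 addr0.
    by rewrite linearZ /= v'r (negPf ji) raddf0 scaler0 mxE.
  (* The coefficient at [i] vanishes, so the point put there is arbitrary. *)
  exists (d + 1 + 1)%N, (fun j => if j == i then q j0 else q j), a; split.
  - by move=> j; apply: sub_conv_hull; case: eqVneq => [_|ji]; [exists j0|exists j].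
  - exact: bary_sum.
  - rewrite -[x](row_mxKl _ (0 : 'rV_1)) -xE linear_sum /=; apply: eq_bigr => j _.
    by rewrite linearZ /=; case: eqVneq => [->|//]; rewrite ai !scale0r.
- exact: iterated_Pyr1.
exists (invmx V), (- (w *m map_mx intr (invmx V))); split.
- by apply/det_unimodular; rewrite unitmx_inv.
- by apply: latticeN; exact: lattice_mul.
have -> : Pyr (conv_hull A) = simplex_of v'.
  rewrite /Pyr image_conv_hull => [|x y t]; last first.
    by rewrite !scale_row_mx add_row_mx !scaler0 addr0.
  have rowA : [set row_mx x (0 : 'rV[R]_1) | x in A] `<=` range v'.
    by move=> _ [_ [j ji <-] <-]; exists j => //; rewrite v'q.
  apply/seteqP; split; apply: conv_hull_min;
    do ?[by apply/convex_setP => *; exact: conv_hull_convex].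
    move=> _ [/(conv_hull_sub rowA)//|->].
    by rewrite -v'i; apply: sub_conv_hull; exists i.
  move=> _ [j _ <-]; apply: sub_conv_hull.
  have [->|ji] := eqVneq j i; [right; exact: v'i|left].
  by apply: sub_conv_hull; rewrite v'q//; exists (q j) => //; exists j.
rewrite image_aff_simplex; congr simplex_of; apply/funext => j.
by rewrite /v' /f mulmxDl addrK -mulmxA unimodular_inv// mulmx1.
Qed.

End Pyramids.
(** * Weights of Gorenstein simplices *)

Section Gorenstein.
Variable R : realType.

(** The vertices of the polar polytope are lattice points, so each facet of the
    dilate lies at lattice distance one from the origin of the reflexive
    polytope: the coordinate opposite to it takes values in the multiples of
    the weight. *)
Lemma Gorenstein_weights d (v : 'I_(d + 1) -> 'rV[R]_d) :
  (0 < d)%N -> hmat v \in unitmx -> (forall i, lattice (v i)) ->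
  Gorenstein (simplex_of v) ->
  exists (r : nat) (lam : 'rV[R]_(d + 1)),
    [/\ (0 < r)%N, forall i, 0 < lam 0 i,
        exists2 p, lattice p & lam *m hmat v = row_mx p (const_mx r%:R) &
        forall a : 'rV[R]_(d + 1), lattice (a *m hmat v) ->
          forall i, exists m : int, a 0 i = lam 0 i * m%:~R].
Proof.
move=> d0 vu vl [_ _ [r [Q [r0 [_ _ Q0 [_ polQ]] [U [w [/det_unimodular Uu wl QE]]]]]]].
have rR : 0 < r%:R :> R by rewrite ltr0n.
pose q i := (r%:R *: v i) *m map_mx intr U + w.
have {}QE : Q = simplex_of q by rewrite QE dilate_simplex image_aff_simplex.
have qu : hmat q \in unitmx.
  rewrite hmat_aff hmat_dilate !unitmx_mul vu !aff_mx_unit ?unimodular_unit//.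
  by rewrite unitmxE det_scalar unitrX// unitfE gt_eqF.
have b0 i : 0 < bary q 0 0 i by move: Q0 i; rewrite QE => /interior_simplexP; apply.
have dl i : lattice (dual q i).
  by apply: polQ; rewrite QE polar_simplex//; apply: vertex_of_simplex; exact: dual_unit.
have sumq (a : 'I_(d + 1) -> R) : \sum_i a i *: q i =
    r%:R *: ((\sum_i a i *: v i) *m map_mx intr U) + (\sum_i a i) *: w.
  rewrite mulmx_suml scaler_sumr scaler_suml -big_split; apply: eq_bigr => i _ /=.
  by rewrite scalerDr -!scalemxAl !scalerA mulrC.
(* [q j] lies on the facet opposite to [q i], where the dual point takes the
   value one. *)
have facet i : exists k : int, 1 - dot w (dual q i) = r%:R * k%:~R.
  have [j ji] := exists_neq i d0.
  have /intrP[k kE] := dot_int (lattice_mul U (vl j)) (dl i).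
  exists k; have := vertex_dual qu b0 i j.
  rewrite eq_sym (negPf ji) mul0r subr0 /q dotDl -scalemxAl dotZl kE.
  by move/(canRL (addrK _)) => ->.
exists r, (r%:R *: bary q 0); split=> // [i||a]; first by rewrite mxE mulr_gt0.
  exists (\sum_i (r%:R *: bary q 0) 0 i *: v i); last first.
    rewrite mul_hmat; congr (row_mx _ (const_mx _)).
    by under eq_bigr do rewrite mxE; rewrite -mulr_sumr bary_sum// mulr1.
  have := sumq (fun i => bary q 0 0 i); rewrite sum_bary// bary_sum// scale1r.
  rewrite scalemxAl scaler_sumr; under eq_bigr do rewrite scalerA.
  move/esym/eqP; rewrite addr_eq0 => /eqP pU.
  under eq_bigr do rewrite mxE.
  rewrite -[\sum_i _]mulmx1 -(unimodular_inv R Uu) mulmxA pU.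
  by apply: lattice_mul; exact: latticeN.
rewrite mul_hmat => /lattice_row_mx[xl ml] i.
have /intrP[m mE] := ml 0; rewrite mxE in mE.
have /intrP[l lE] := dot_int (lattice_mul U xl) (dl i).
have [k kE] := facet i.
exists (m * k - l).
rewrite mxE; have := dot_sum_vertex qu b0 (fun j => a 0 j) i.
rewrite sumq mE dotDl !dotZl lE => H.
have -> : a 0 i = bary q 0 0 i * (m%:~R - (m%:~R - a 0 i / bary q 0 0 i)).
  by field; rewrite gt_eqF.
rewrite -H rmorphB rmorphM /=.
suff -> : m%:~R - (r%:R * l%:~R + m%:~R * dot w (dual q i)) =
  m%:~R * (1 - dot w (dual q i)) - r%:R * l%:~R by rewrite kE; ring.
ring.
Qed.

Lemma codeg_neq0 d (P : set 'rV[R]_d) : codeg P <> 0%N -> is_codeg P (codeg P).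
Proof. by rewrite /codeg; case: xgetP. Qed.

Lemma is_codeg_unique d (P : set 'rV[R]_d) m : is_codeg P m -> codeg P = m.
Proof.
move=> Pm; have Pc : is_codeg P (codeg P) by apply: (xgetI _ Pm).
have [[gm minm] [gc minc]] := (Pm, Pc).
by apply/eqP; rewrite eqn_leq minc ?minm.
Qed.

End Gorenstein.

(** * Half-integral groups and codes *)

Section HalfCodes.
Variable R : realType.

Lemma F2_eq1 (a : 'F_2) : (a == 1) = (a != 0).
Proof. by case: a => [[|[|]]]. Qed.

Lemma half_vecE n (c : 'rV['F_2]_n) i : half_vec R c 0 i = (c 0 i != 0)%:R / 2.
Proof. by rewrite mxE F2_eq1; case: eqVneq; rewrite ?mul0r ?mul1r. Qed.

Lemma half_vec0 n : half_vec R (0 : 'rV['F_2]_n) = 0.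
Proof. by apply/rowP => i; rewrite half_vecE mxE eqxx mul0r mxE. Qed.

Lemma half_vec_range n (c : 'rV['F_2]_n) i : 0 <= half_vec R c 0 i < 1.
Proof. by rewrite half_vecE; case: eqP => _ /=; lra. Qed.

Lemma half_vecD n (c c' : 'rV['F_2]_n) :
  lattice (half_vec R (c + c') - (half_vec R c + half_vec R c')).
Proof.
move=> i; have -> : (half_vec R (c + c') - (half_vec R c + half_vec R c')) 0 i =
    half_vec R (c + c') 0 i - (half_vec R c 0 i + half_vec R c' 0 i) by rewrite !mxE.
rewrite !half_vecE mxE.
rewrite [c 0 i]F2E [c' 0 i]F2E.
case: (c 0 i != 0); case: (c' 0 i != 0) => /=.
- have -> : 0 / 2 - (1 / 2 + 1 / 2) = - 1 :> R by field.
  by rewrite rpredN; exact: int_num1.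
- by rewrite mul0r addr0 subrr.
- by rewrite mul0r add0r subrr.
- by rewrite mul0r addr0 subrr.
Qed.

Lemma half_vecP n (x : 'rV[R]_n) :
  (forall i, 0 <= x 0 i < 1 /\ 2 * x 0 i \is a Num.int) ->
  exists c, x = half_vec R c.
Proof.
move=> xh; exists (\row_i (x 0 i != 0)%:R); apply/rowP => i.
rewrite half_vecE mxE; have [/andP[x0 x1] /intrP[m mE]] := xh i.
have [->|xn0] := eqVneq (x 0 i) 0; first by rewrite eqxx mul0r.
rewrite oner_neq0.
have m1 : m = 1.
  have : (0 < m%:~R :> R) && (m%:~R < 2 :> R).
    by rewrite -mE; have : 0 < x 0 i; [rewrite lt_neqAle eq_sym xn0|lra].
  by rewrite ltr0z -[2]/(2%:~R) ltr_int; case: m {mE} => [[|[|]]|].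
have E : 2 * x 0 i = 1 by rewrite mE m1.
by rewrite /=; lra.
Qed.

(** Modulo one, halving turns addition of codewords into addition of points, so
    the codewords whose halves lie in the group form a subspace; the height
    coordinate being integral makes it even. *)
Lemma Lambda_code d n (v : 'I_n -> 'rV[R]_d) :
  (forall i, lattice (v i)) ->
  exists2 C : {vspace 'rV['F_2]_n}, even_code C &
    forall c, c \in C <-> Lambda v (half_vec R c).
Proof.
move=> vl.
pose S := [seq c <- enum {: 'rV['F_2]_n} | `[< Lambda v (half_vec R c) >]].
have SP c : c \in S <-> Lambda v (half_vec R c).
  by rewrite mem_filter mem_enum andbT; split=> /asboolP.
have CP c : c \in <<S>>%VS <-> Lambda v (half_vec R c).
  split=> [/(coord_span (X := in_tuple S))->|/SP]; last exact: memv_span.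
  apply/LambdaP; split; first exact: half_vec_range.
  elim/big_ind : _ => [|x y xl yl|i _].
  - by rewrite half_vec0 mul0mx => j; rewrite mxE.
  - rewrite -[half_vec R (x + y)](subrK (half_vec R x + half_vec R y)).
    rewrite mulmxDl; apply: latticeD; last by rewrite mulmxDl; exact: latticeD.
    by apply: lattice_comb => //; exact: half_vecD.
  - have /SP/LambdaP[_ Sl] : (in_tuple S)`_i \in S by apply: mem_nth; rewrite /= ltn_ord.
    rewrite [coord _ _ _]F2E; case: (_ != 0); rewrite ?scale1r ?scale0r//.
    by rewrite half_vec0 mul0mx => j; rewrite mxE.
exists <<S>>%VS => // c /CP/LambdaP[_]; rewrite mul_hmat => /lattice_row_mx[_ /(_ 0)].
rewrite mxE; under eq_bigr do rewrite half_vecE.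
rewrite -mulr_suml -natr_sum => /intrP[m mE].
set k := #|_|; have -> : k = (\sum_(i < n) (c 0 i != 0)%R)%N.
  by rewrite /k -sum1_card big_mkcond; apply: eq_bigr => i _; rewrite inE; case: ifP.
move: mE; set t := (\sum_(i < n) _)%N => mE.
have : t%:Z = m * 2.
  by apply: (@intr_inj R); rewrite rmorphM /= -mE divfK.
by move=> tE; rewrite -dvdn2 -[(2 %| t)%N]/(2%:Z %| t%:Z)%Z tE dvdz_mull.
Qed.

End HalfCodes.
(** * The classification *)

Section Classification.
Variable R : realType.

Lemma codeg_of_degree d s (P : set 'rV[R]_d) :
  (0 < s)%N -> (d + 1 = 2 * s)%N -> degree P = s%:Z -> is_codeg P s.
Proof.
move=> s0 ds; rewrite /degree -addn1 ds => dP.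
have cs : codeg P = s by lia.
by rewrite -[X in is_codeg _ X]cs; apply: codeg_neq0; rewrite cs; lia.
Qed.

Lemma sum_half n s : (n = 2 * s)%N -> \sum_(i < n) (1 / 2) = s%:R :> R.
Proof.
move=> ->; rewrite sumr_const card_ord -[LHS]mulr_natr natrM mulrA divfK//.
exact: mul1r.
Qed.

(** The weights are inverses of integers, and no weight is one since the simplex
    is not a pyramid; so [2 s] weights of size at most [1 / 2] sum to [r], which
    is at least [s] by the codegree, and all of them equal [1 / 2]. *)
Lemma Gorenstein_half_weights d s (v : 'I_(d + 1) -> 'rV[R]_d) :
  (0 < s)%N -> (d + 1 = 2 * s)%N -> hmat v \in unitmx ->
  (forall i, lattice (v i)) -> Gorenstein (simplex_of v) ->
  is_codeg (simplex_of v) s -> ~ lattice_pyramid (simplex_of v) ->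
  lattice (const_mx (1 / 2) *m hmat v) /\
  forall x, Lambda v x -> forall i, 2 * x 0 i \is a Num.int.
Proof.
move=> s0 ds vu vl Gv [_ cs] npyr.
have d0 : (0 < d)%N by lia.
have [r [lam [r0 lam0 [p pl lamE] div]]] := Gorenstein_weights d0 vu vl Gv.
have lam2 i : lam 0 i <= 1 / 2.
  have [k kE] : exists k : int, 1 = lam 0 i * k%:~R.
    have [|k] := div (delta_mx 0 i) _ i.
      by rewrite -rowE rowK; exact: lattice_homog.
    by rewrite mxE !eqxx; exists k.
  have [k1|k2] := leP k 1; last first.
    have : 2%:~R <= k%:~R :> R by rewrite ler_int.
    move=> k2R; have := lam0 i; nra.
  have k1' : k = 1.
    have : 0 < k%:~R :> R by rewrite -(pmulr_rgt0 _ (lam0 i)) -kE ltr01.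
    by rewrite ltr0z; lia.
  exfalso; apply: npyr; apply: (@Lambda0_pyramid _ _ _ i) => // x /LambdaP[x01 xl].
  apply: int01_eq0 => //; have [m ->] := div _ xl i.
  by move: kE; rewrite k1' mulr1 => <-; rewrite mul1r.
have sumlam : \sum_i lam 0 i = r%:R.
  by move: lamE; rewrite mul_hmat => /eq_row_mx[_ /rowP/(_ 0)]; rewrite !mxE.
have sr : (s <= r)%N.
  apply: cs; split=> //; exists p; split=> //.
  by apply/dilate_interiorP => //; exists lam.
have lamh i : lam 0 i = 1 / 2.
  have : \sum_i (1 / 2 - lam 0 i) <= 0.
    by rewrite sumrB sumlam (sum_half ds) subr_le0 ler_nat.
  have ge0 j : 0 <= 1 / 2 - lam 0 j by rewrite subr_ge0.
  rewrite le_eqVlt ltNge sumr_ge0// orbF psumr_eq0// => /allP/(_ i).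
  by rewrite mem_index_enum subr_eq0 => /(_ isT)/eqP.
split=> [|x /LambdaP[_ xl] i].
  rewrite (_ : const_mx _ = lam); last by apply/rowP => i; rewrite lamh mxE.
  by rewrite lamE; apply/lattice_row_mx; split=> // i; rewrite mxE.
have [m ->] := div _ xl i; rewrite lamh mulrA [2 * _]mulrC divfK// mul1r.
exact: intr_int.
Qed.

Lemma half_vec1 n : half_vec R (const_mx 1 : 'rV['F_2]_n) = const_mx (1 / 2).
Proof. by apply/rowP => i; rewrite half_vecE !mxE. Qed.

Lemma code_of_Gorenstein_simplex d s (v : 'I_(d + 1) -> 'rV[R]_d) :
  (0 < s)%N -> (d + 1 = 2 * s)%N -> lattice_simplex v ->
  Gorenstein (simplex_of v) -> degree (simplex_of v) = s%:Z ->
  ~ lattice_pyramid (simplex_of v) ->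
  exists C : {vspace 'rV['F_2]_(d + 1)},
    [/\ even_code C, self_complementary C &
        Lambda v = [set half_vec R c | c in [set c | c \in C]]].
Proof.
move=> s0 ds [/affinely_independentP vu [_ vvl]] Gv dv npyr.
have vl i : lattice (v i) by apply: vvl; exact: vertex_of_simplex.
have [hl hx] := Gorenstein_half_weights s0 ds vu vl Gv (codeg_of_degree s0 ds dv) npyr.
have [C evC CP] := Lambda_code vl.
exists C; split=> //.
  by apply/CP/LambdaP; split; [exact: half_vec_range|rewrite half_vec1].
apply/seteqP; split=> [x xL|_ [c cC <-]]; last exact/CP.
have [c xc] : exists c, x = half_vec R c.
  by apply: half_vecP => i; split; [case/LambdaP: xL|exact: hx].
by exists c => //=; apply/CP; rewrite -xc.
Qed.

(** The vertices are the unit vectors, written in a basis of the lattice spanned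
    by the integral vectors and the halved codewords; the coordinate sum being
    the last coordinate in that basis puts them at height one. *)
Lemma code_simplex d (C : {vspace 'rV['F_2]_(d + 1)}) :
  even_code C ->
  exists v : 'I_(d + 1) -> 'rV[R]_d,
    [/\ hmat v \in unitmx, forall i, lattice (v i) &
      forall a : 'rV[R]_(d + 1), lattice (a *m hmat v) <->
        exists2 z : 'rV[int]_(d + 1),
          map_mx intr z \in C & 2 *: a = map_mx intr z].
Proof.
move=> evC; have [X [B [XB X1 BC]]] := even_code_lattice_basis evC.
pose XR : 'M[R]_(d + 1) := map_mx intr X.
pose BR : 'M[R]_(d + 1) := map_mx intr B.
have XBR : XR *m BR = 2%:M by rewrite -map_mxM XB map_scalar_mx rmorph_nat.
pose v i := lsubmx (row i XR).
have vX : hmat v = XR.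
  apply/row_matrixP => i; rewrite rowK /homog -[RHS]hsubmxK; congr row_mx.
  apply/rowP => j; have := congr1 (fun M : 'cV[int]_(d + 1) => M i 0) X1.
  by rewrite -colE /= !mxE ord1 => ->; rewrite rmorph1.
have XR1 : XR *m (2^-1 *: BR) = 1%:M.
  rewrite -scalemxAr XBR -[2%:M]mulmx1 mul_scalar_mx scalerA mulVf//.
  by rewrite scale1r.
exists v; rewrite vX; split=> [|i|a]; first by case: (mulmx1_unit XR1).
  by apply/latticeP; exists (lsubmx (row i X)); rewrite map_lsubmx map_row.
split=> [/latticeP[z zE]|[z /BC[z' ->] aE]].
  exists (z *m B); first by apply/BC; exists z.
  by rewrite map_mxM -zE -mulmxA XBR mul_mx_scalar.
apply/latticeP; exists z'.
have -> : a = map_mx intr z' *m (2^-1 *: BR).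
  by rewrite -scalemxAr -map_mxM -aE scalerA mulVf// scale1r.
by rewrite -mulmxA (mulmx1C XR1) mulmx1.
Qed.

Section CodeSimplex.
Variables (d s : nat) (C : {vspace 'rV['F_2]_(d + 1)}) (v : 'I_(d + 1) -> 'rV[R]_d).
Hypotheses (s0 : (0 < s)%N) (ds : (d + 1 = 2 * s)%N) (scC : self_complementary C).
Hypotheses (vu : hmat v \in unitmx) (vl : forall i, lattice (v i)).
Hypothesis latP : forall a : 'rV[R]_(d + 1), lattice (a *m hmat v) <->
  exists2 z : 'rV[int]_(d + 1), map_mx intr z \in C & 2 *: a = map_mx intr z.

Lemma Lambda_code_simplex : Lambda v = [set half_vec R c | c in [set c | c \in C]].
Proof.
pose lift (c : 'rV['F_2]_(d + 1)) : 'rV[int]_(d + 1) := \row_i (c 0 i != 0)%:R.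
have liftF c : map_mx intr (lift c) = c.
  by apply/rowP => i; rewrite !mxE [RHS]F2E; case: eqVneq; rewrite ?rmorph0 ?rmorph1.
have liftR c : 2 *: half_vec R c = map_mx intr (lift c).
  apply/rowP => i; rewrite [LHS]mxE half_vecE !mxE.
  by case: eqVneq => _; rewrite ?rmorph0 ?rmorph1 /=; field.
apply/seteqP; split=> [x /LambdaP[x01 /latP[z zC xz]]|_ [c cC <-]]; last first.
  apply/LambdaP; split; first exact: half_vec_range.
  by apply/latP; exists (lift c); rewrite ?liftF ?liftR.
have [c xc] : exists c, x = half_vec R c.
  apply: half_vecP => i; split=> //.
  by have /rowP/(_ i) := xz; rewrite !mxE => ->.
exists c => //=; rewrite -(liftF c); suff -> : lift c = z by [].
apply/rowP => i; apply: (@intr_inj R).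
by have := xz; rewrite xc liftR => /rowP/(_ i); rewrite ![map_mx _ _ _ _]mxE.
Qed.

Let center : 'rV[R]_d := \sum_i (const_mx (1 / 2) : 'rV[R]_(d + 1)) 0 i *: v i.

Let sR : 0 < s%:R :> R. Proof. by rewrite ltr0n. Qed.

Let centerE : const_mx (1 / 2) *m hmat v = row_mx center (const_mx s%:R).
Proof.
rewrite mul_hmat; congr (row_mx _ (const_mx _)).
under eq_bigr do rewrite mxE.
exact: sum_half.
Qed.

Let center_lattice : lattice center.
Proof.
have : lattice ((const_mx (1 / 2) : 'rV[R]_(d + 1)) *m hmat v).
  apply/latP; exists (const_mx 1); last by apply/rowP => i; rewrite !mxE; field.
  by rewrite map_const_mx rmorph1.
by rewrite centerE => /lattice_row_mx[].
Qed.

Lemma code_simplex_codeg : is_codeg (simplex_of v) s.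
Proof.
split=> [|m [m0 [x [/(dilate_interiorP _ vu m0)[a a0 aE] xl]]]].
  split=> //; exists center; split; last exact: center_lattice.
  apply/dilate_interiorP => //.
  by exists (const_mx (1 / 2)) => // i; rewrite mxE.
have /latP[z _ az] : lattice (a *m hmat v).
  by rewrite aE; apply/lattice_row_mx; split=> // i; rewrite mxE.
have half i : 1 / 2 <= a 0 i.
  have /rowP/(_ i) := az; rewrite mxE [RHS]mxE => ai.
  have : 0 < (z 0 i)%:~R :> R by rewrite -ai mulr_gt0.
  rewrite ltr0z => z0; have : 1%:~R <= (z 0 i)%:~R :> R by rewrite ler_int; lia.
  by rewrite -ai; lra.
rewrite -(@ler_nat R).
have -> : m%:R = \sum_i a 0 i :> R.
  by move: aE; rewrite mul_hmat => /eq_row_mx[_ /rowP/(_ 0)]; rewrite !mxE.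
by rewrite -(sum_half ds); apply: ler_sum => i _.
Qed.

(** Once the centre of the [s]-th dilate is moved to the origin, the [k]-th entry
    of the [i]-th dual point is [1 - 2 a i], where [a] are the coordinates of the
    lattice point at height [s] obtained by adding the [k]-th unit vector to the
    centre; these are half-integral. *)
Lemma Gorenstein_code_simplex : Gorenstein (simplex_of v).
Proof.
split; [exact: simplex_lattice_polytope|exact: simplex_has_dim|].
exists s, [set x *m map_mx intr 1%:M - center | x in dilate s (simplex_of v)]; split=> //.
  rewrite dilate_simplex image_aff_simplex.
  set q := fun i : 'I_(d + 1) => _.
  have qE : hmat q = hmat v *m aff_mx s%:R%:M 0 *m aff_mx 1%:M (- center).
    by rewrite hmat_aff hmat_dilate map_scalar_mx rmorph1.
  have qu : hmat q \in unitmx.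
    rewrite qE !unitmx_mul vu !aff_mx_unit ?unitmx1//.
    by rewrite unitmxE det_scalar unitrX// unitfE gt_eqF.
  have ql i : lattice (q i).
    rewrite /q; apply: latticeD; last exact: latticeN.
    by apply: lattice_mul => j; rewrite mxE; apply: rpredM; [exact: natr_int|exact: vl].
  have bq : bary q 0 = const_mx (1 / 2 / s%:R).
    apply: (hmat_inj qu); rewrite bary_hmat// qE mulmxA mulmxA.
    rewrite (_ : const_mx _ = s%:R^-1 *: const_mx (1 / 2)); last first.
      by apply/rowP => i; rewrite !mxE mulrC.
    rewrite -scalemxAl centerE scale_row_mx (_ : _ *: const_mx _ = const_mx 1); last first.
      by apply/rowP => i; rewrite !mxE mulVf// gt_eqF.
    rewrite !row_aff_mx scaler0 addr0 mulmx1 mul_mx_scalar scalerA mulfV ?gt_eqF//.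
    by rewrite !scale1r subrr.
  have b0 i : 0 < bary q 0 0 i by rewrite bq mxE; do ?apply: divr_gt0.
  have comb x : \sum_j (s%:R *: bary q x) 0 j *: v j = x + center.
    have cE : center = \sum_j bary q x 0 j *: center.
      by rewrite -scaler_suml bary_sum// scale1r.
    rewrite -[X in _ = X + _](sum_bary qu x) [X in _ = _ + X]cE.
    rewrite -big_split; apply: eq_bigr => j _ /=.
    rewrite -scalerDr /q subrK map_scalar_mx rmorph1 mulmx1 scalerA.
    by congr (_ *: _); rewrite [LHS]mxE mulrC.
  have dl i : lattice (dual q i).
    move=> k; have := bary_dual b0 (delta_mx 0 k) i.
    rewrite dotE -rowE [row _ _ _ _]mxE [_^T _ _]mxE bq [const_mx _ _ _]mxE => E.
    have /latP[z _ zE] : lattice ((s%:R *: bary q (delta_mx 0 k)) *m hmat v).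
      rewrite mul_hmat; apply/lattice_row_mx; rewrite comb; split.
        by apply: latticeD => // j; rewrite mxE.
      move=> j; rewrite mxE; under eq_bigr do rewrite mxE.
      by rewrite -mulr_sumr bary_sum// mulr1 natr_int.
    have /rowP/(_ i) := zE; rewrite mxE [RHS]mxE [(_ *: bary _ _) _ _]mxE E => zi.
    have -> : dual q i 0 k = 1 - (z 0 i)%:~R by rewrite -zi; field; rewrite gt_eqF.
    by rewrite rpredB// ?int_num1 // intr_int.
  split; [exact: simplex_lattice_polytope|exact: simplex_has_dim| |].
    exact/interior_simplexP.
  by rewrite polar_simplex//; exact: simplex_lattice_polytope.
exists 1%:M, (- center); split=> //; [by left; rewrite det1|exact: latticeN].
Qed.

Lemma code_simplex_not_pyramid : ~ lattice_pyramid (simplex_of v).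
Proof.
move=> /(pyramid_Lambda0 vu)[i]; rewrite Lambda_code_simplex.
move=> /(_ (const_mx (1 / 2))); rewrite mxE => H.
suff : (1 / 2 : R) = 0 by lra.
by apply: H; exists (const_mx 1) => //; exact: half_vec1.
Qed.

End CodeSimplex.

Lemma Gorenstein_simplex_of_code d s (C : {vspace 'rV['F_2]_(d + 1)}) :
  (0 < s)%N -> (d + 1 = 2 * s)%N -> even_code C -> self_complementary C ->
  exists v : 'I_(d + 1) -> 'rV[R]_d,
    (lattice_simplex v /\ has_dim (simplex_of v) d) /\
    [/\ Gorenstein (simplex_of v), degree (simplex_of v) = s%:Z,
        ~ lattice_pyramid (simplex_of v) &
        Lambda v = [set half_vec R c | c in [set c | c \in C]]].
Proof.
move=> s0 ds evC scC; have [v [vu vl latP]] := code_simplex evC.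
exists v; split; split.
- by split; [exact/affinely_independentP|exact: simplex_lattice_polytope].
- exact: simplex_has_dim.
- exact: (Gorenstein_code_simplex s0 ds scC vu vl latP).
- have cs := code_simplex_codeg s0 ds scC vu latP.
  by rewrite /degree (is_codeg_unique cs) -addn1 ds; lia.
- exact: (code_simplex_not_pyramid scC vu latP).
- exact: Lambda_code_simplex.
Qed.

End Classification.

Theorem theorem1p1 (R : realType) (s : nat) (hs : (1 <= s)%N) :
  (forall v : 'I_(2 * s) -> 'rV[R]_(2 * s - 1),
     lattice_simplex v -> has_dim (simplex_of v) (2 * s - 1) ->
     Gorenstein (simplex_of v) -> degree (simplex_of v) = s%:Z ->
     ~ lattice_pyramid (simplex_of v) ->
     exists C : {vspace 'rV['F_2]_(2 * s)},
       [/\ even_code C, self_complementary C &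
           Lambda v = [set half_vec R c | c in [set c | c \in C]]])
  /\
  (forall C : {vspace 'rV['F_2]_(2 * s)},
     even_code C -> self_complementary C ->
     exists v : 'I_(2 * s) -> 'rV[R]_(2 * s - 1),
       (lattice_simplex v /\ has_dim (simplex_of v) (2 * s - 1)) /\
       [/\ Gorenstein (simplex_of v), degree (simplex_of v) = s%:Z,
           ~ lattice_pyramid (simplex_of v) &
           Lambda v = [set half_vec R c | c in [set c | c \in C]]]).
Proof.
(* The number of vertices has to read [d + 1] for [hmat v] to be square. *)
have [d [n [-> nE dn]]] : exists d n,
    [/\ (2 * s - 1 = d)%N, (2 * s = n)%N & (d + 1 = n)%N].
  by exists (2 * s - 1)%N, (2 * s)%N; split=> //; lia.
have ds : (d + 1 = 2 * s)%N by rewrite dn nE.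
rewrite nE -dn; split=> [v vs _|C]; last exact: Gorenstein_simplex_of_code.
exact: code_of_Gorenstein_simplex.
Qed.
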